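(* Let $M$ be a Riemannian manifold, let $R$ be a retraction on $M$, let $f:M\to\mathbb{R}$ be a smooth function, and let $\mu>1/4$. Let $\{x_k\}_{k=0,1,\dots}\subset M$, with search directions $\eta_k\in T_{x_k}M$, step sizes $\alpha_k>0$ and parameters $\beta_{k+1}\in\mathbb{R}$, be any sequence generated by the Riemannian conjugate gradient iteration described in the context, where the step sizes $\alpha_k>0$ are arbitrary. Write $g_k:=\operatorname{grad} f(x_k)$. Suppose that for every $k$ the parameter used is $$\beta_{k+1}=\beta^{\mathrm{SD}}_{k+1}:=\langle g_{k+1},\xi_{k+1}\rangle_{x_{k+1}}-\mu\|\xi_{k+1}\|_{x_{k+1}}^2\left\langle g_{k+1},\mathcal{T}^S_{\alpha_k\eta_k}(\eta_k)\right\rangle_{x_{k+1}},$$ where $\xi_{k+1}\in T_{x_{k+1}}M$ is an arbitrary tangent vector. Then, for all $k=0,1,\dots$, $$\langle g_k,\eta_k\rangle_{x_k}\le-\left(1-\frac{1}{4\mu}\right)\|g_k\|_{x_k}^2.$$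
   Context: For a Riemannian manifold $M$, $\langle\cdot,\cdot\rangle_x$ denotes the Riemannian metric on $T_xM$, $\|\cdot\|_x$ the induced norm, and $\operatorname{grad} f(x)\in T_xM$ the Riemannian gradient of $f$ at $x$. $\mathrm{D}F(x)$ denotes the differential of a smooth map $F$ at $x$. A retraction on $M$ is a smooth map $R:TM\to M$ such that, with $R_x:=R|_{T_xM}$, one has for every $x\in M$: $R_x(0_x)=x$, where $0_x$ is the zero element of $T_xM$; and, under the canonical identification $T_{0_x}T_xM\simeq T_xM$, $\mathrm{D}R_x(0_x)[\xi]=\xi$ for all $\xi\in T_xM$. For $x\in M$ and $\eta,\xi\in T_xM$, the differentiated retraction is $\mathcal{T}^R_\eta(\xi):=\mathrm{D}R_x(\eta)[\xi]\in T_{R_x(\eta)}M$ (identifying $T_\eta T_xM\simeq T_xM$). The scaled vector transport with respect to $R$ is $$\mathcal{T}^S_\eta(\xi):=\begin{cases}\mathcal{T}^R_\eta(\xi), & \text{if } \|\mathcal{T}^R_\eta(\xi)\|_{R_x(\eta)}\le\|\xi\|_x,\\[4pt] \dfrac{\|\xi\|_x}{\|\mathcal{T}^R_\eta(\xi)\|_{R_x(\eta)}}\,\mathcal{T}^R_\eta(\xi), & \text{otherwise.}\end{cases}$$ Riemannian conjugate gradient iteration: given an initial point $x_0\in M$, set $g_0:=\operatorname{grad} f(x_0)$ and $\eta_0:=-g_0$. For $k=0,1,\dots$, choose a step size $\alpha_k>0$, set $x_{k+1}:=R_{x_k}(\alpha_k\eta_k)$ and $g_{k+1}:=\operatorname{grad}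 f(x_{k+1})$, choose a parameter $\beta_{k+1}\in\mathbb{R}$, and set $$\eta_{k+1}:=-g_{k+1}+\beta_{k+1}\mathcal{T}^S_{\alpha_k\eta_k}(\eta_k).$$ *)

(* Defs.v *)
From HB Require Import structures.
From mathcomp Require Import all_boot all_order all_algebra.
From mathcomp Require Import all_classical all_reals all_analysis.
Set Implicit Arguments.
Unset Strict Implicit.
Unset Printing Implicit Defensive.
Import Order.TTheory GRing.Theory Num.Theory.
Import numFieldNormedType.Exports.
Local Open Scope classical_set_scope.
Local Open Scope ring_scope.

Section Smooth.
Context {R : realType} {V W : normedModType R}.

Definition iter_derive (vs : seq V) (F : V -> W) : V -> W :=
  foldr (fun v G => 'D_v G) F vs.

(* C^infinity on a set A, meant for A open: all iterated directional
   derivatives exist and are (Frechet) differentiable on A. *)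
Definition smooth_on (A : set V) (F : V -> W) : Prop :=
  forall vs a, A a -> differentiable (iter_derive vs F) a.

End Smooth.

(* A chart is a homeomorphism from the open set [cdom] onto the open set
   [crange] of R^n; outside these sets [cfun] and [cinv] carry no meaning. *)
Record chart (R : realType) (n : nat) (X : topologicalType) := Chart {
  cdom : set X;
  crange : set 'rV[R]_n;
  cfun : X -> 'rV[R]_n;
  cinv : 'rV[R]_n -> X;
  cdom_open : open cdom;
  crange_open : open crange;
  cfun_range : forall x, cdom x -> crange (cfun x);
  cinv_dom : forall u, crange u -> cdom (cinv u);
  cfunK : forall x, cdom x -> cinv (cfun x) = x;
  cinvK : forall u, crange u -> cfun (cinv u) = u;
  cfun_cont : forall x, cdom x -> {for x, continuous cfun};
  cinv_cont : forall u, crange u -> {for u, continuous cinv} }.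

Record manifold (R : realType) (n : nat) := Manifold {
  mcarrier :> topologicalType;
  atlas : set (chart R n mcarrier);
  mhausdorff : hausdorff_space mcarrier;
  msecond_countable : @second_countable mcarrier;
  atlas_cover : forall x, exists2 c, atlas c & cdom c x;
  atlas_smooth : forall c d, atlas c -> atlas d ->
    smooth_on (cfun c @` (cdom c `&` cdom d)) (cfun d \o cinv c) }.

Section Tangent.
Context {R : realType} {n : nat} {M : manifold R n}.

Definition chart_at (x : M) : chart R n M := s2val (cid2 (atlas_cover x)).

(* T_x M, represented by coordinates in the chart [chart_at x]. *)
Definition tangent (x : M) : Type := 'rV[R]_n.

HB.instance Definition _ (x : M) :=
  GRing.Lmodule.on (tangent x).

Definition tangent_cast (x y : M) (e : x = y) (v : tangent x) : tangent y :=
  ecast z (tangent z) e v.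

(* The vector of T_x M whose coordinates in the chart c (around x) are w. *)
Definition tvec (c : chart R n M) (x : M) (w : 'rV[R]_n) : tangent x :=
  'd (cfun (chart_at x) \o cinv c) (cfun c x) w.

Definition smooth_fun (f : M -> R) : Prop :=
  forall c, atlas c -> smooth_on (crange c) (f \o cinv c).

(* Df(x)[v] *)
Definition dfun (f : M -> R) (x : M) (v : tangent x) : R :=
  'd (f \o cinv (chart_at x)) (cfun (chart_at x) x) v.

(* Smoothness of a map T M -> M, read in the charts that the atlas of M
   induces on T M: (u, w) stands for the tangent vector at [cinv c u] with
   coordinates w in the chart c. Openness of the domains of the local
   expressions amounts to continuity of the map. *)
Definition smooth_bundle_map (Q : forall x : M, tangent x -> M) : Prop :=
  forall c d, atlas c -> atlas d ->
  let q (p : 'rV[R]_n * 'rV[R]_n) :=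
    Q (cinv c p.1) (tvec c (cinv c p.1) p.2) in
  let A := [set p | crange c p.1 /\ cdom d (q p)] in
  open A /\ smooth_on A (cfun d \o q).

(* DQ(eta)[xi] for Q : T_x M -> M, under T_eta (T_x M) = T_x M. *)
Definition dtangent (x : M) (Q : tangent x -> M) (eta xi : tangent x) :
    tangent (Q eta) :=
  'd (cfun (chart_at (Q eta)) \o Q : 'rV[R]_n -> 'rV[R]_n) eta xi.

End Tangent.

Record riemannian (R : realType) (n : nat) := Riemannian {
  rmanifold :> manifold R n;
  inner : forall x : rmanifold, tangent x -> tangent x -> R;
  innerC : forall (x : rmanifold) (u v : tangent x), inner u v = inner v u;
  inner_linear : forall (x : rmanifold) (a : R) (u v w : tangent x),
    inner (a *: u + v) w = a * inner u w + inner v w;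
  inner_gt0 : forall (x : rmanifold) (v : tangent x), v != 0 -> 0 < inner v v;
  inner_smooth : forall (c : chart R n rmanifold) (v w : 'rV[R]_n), atlas c ->
    smooth_on (crange c) (fun u => inner (tvec c (cinv c u) v)
                                         (tvec c (cinv c u) w)) }.

Arguments inner {R n r} x u v.

Section RiemannianCG.
Context {R : realType} {n : nat} {M : riemannian R n}.

Definition tnorm (x : M) (v : tangent x) : R := Num.sqrt (inner x v v).

Definition grad (f : M -> R) (x : M) : tangent x :=
  get [set g : 'rV[R]_n | forall v : tangent x, inner x g v = dfun f v].

Lemma gradP (f : M -> R) (x : M) (v : tangent x) :
  inner x (grad f x) v = dfun f v.
Proof.
have innerDr (u : tangent x) a (s t : tangent x) :
    inner x u (a *: s + t) = a * inner x u s + inner x u t.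
  by rewrite innerC inner_linear ![inner x _ u]innerC.
have inner0l (u : tangent x) : inner x 0 u = 0.
  have := inner_linear (-1) 0 0 u.
  by rewrite scaler0 addr0 mulN1r addNr.
have inner_sumr (u : tangent x) (F : 'I_n -> tangent x) (a : 'I_n -> R) :
    inner x u (\sum_i a i *: F i) = \sum_i a i * inner x u (F i).
  have inner0r : inner x u 0 = 0 by rewrite innerC.
  rewrite (big_morph (inner x u) (id1 := 0) (op1 := +%R)) //; last first.
    by move=> s t; have := innerDr u 1 s t; rewrite scale1r mul1r.
  apply: eq_bigr => i _.
  by have := innerDr u (a i) (F i) 0; rewrite !addr0 inner0r addr0.
pose e (i : 'I_n) : tangent x := delta_mx 0 i.
have decomp (u : tangent x) : u = \sum_i (u : 'rV[R]_n) 0 i *: e i.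
  exact: row_sum_delta.
pose G : 'M[R]_n := \matrix_(i, j) inner x (e i) (e j).
have Gmul (u : 'rV[R]_n) j : (u *m G) 0 j = inner x (u : tangent x) (e j).
  rewrite mxE innerC [in RHS](decomp u) inner_sumr.
  by apply: eq_bigr => i _; rewrite mxE innerC.
have Gunit : G \in unitmx.
  rewrite -row_free_unit -kermx_eq0; apply/eqP/row_matrixP => i; rewrite row0.
  set u := row i _; have uG : u *m G = 0 by rewrite -row_mul mulmx_ker row0.
  apply/eqP; apply: contraT => u0; have := @inner_gt0 _ _ M x u u0.
  rewrite [X in inner x _ X](decomp u) inner_sumr big1 ?ltxx// => j _.
  by rewrite -Gmul uG [X in _ * X]mxE mulr0.
have dlin (F : {linear 'rV[R]_n -> R}) :
    exists g : 'rV[R]_n, forall w : tangent x, inner x g w = F w.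
  exists ((\row_j F (e j)) *m invmx G) => w.
  rewrite [in LHS](decomp w) inner_sumr [in RHS](decomp w) linear_sum.
  by apply: eq_bigr => j _; rewrite linearZ -Gmul mulmxKV// mxE.
have [g gE] := dlin ('d (f \o cinv (chart_at x)) (cfun (chart_at x) x)).
exact: (getI (P := [set g : 'rV[R]_n | forall v : tangent x,
  inner x g v = dfun f v]) gE) v.
Qed.

Record retraction := Retraction {
  retr :> forall x : M, tangent x -> M;
  retr_smooth : smooth_bundle_map retr;
  retr0 : forall x, retr (0 : tangent x) = x;
  retr_d0 : forall (x : M) (xi : tangent x),
    tangent_cast (retr0 x) (dtangent (retr (x:=x)) 0 xi) = xi }.

(* T^R_eta(xi) = DR_x(eta)[xi] *)
Definition diff_retr (Q : retraction) (x : M) (eta xi : tangent x) :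
  tangent (Q x eta) := dtangent (Q x) eta xi.

(* T^S_eta(xi) *)
Definition scaled_transport (Q : retraction) (x : M) (eta xi : tangent x) :
    tangent (Q x eta) :=
  let v := diff_retr Q eta xi in
  if tnorm v <= tnorm xi then v else (tnorm xi / tnorm v) *: v.

End RiemannianCG.

Arguments retraction {R n} M.

(* Main.v *)
(* With g = grad f(x_{k+1}), a = <g, T> for the transported direction T, and
   xi = xi_{k+1},
     <g, eta_{k+1}> + (1 - 1/(4 mu)) |g|^2 = - |g - 2 mu a xi|^2 / (4 mu) <= 0. *)
Require Import Defs.
From mathcomp Require Import all_boot all_order all_algebra.
From mathcomp Require Import all_classical all_reals all_analysis.
From mathcomp Require Import ring lra.
Import Order.TTheory GRing.Theory Num.Theory.
Local Open Scope ring_scope.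

(** The bound concerns one tangent space at a time, so no induction on [k] is needed. For [k = 0]
    the direction is [-g]. For later [k], [inner_SD_le] treats the transported direction as an
    arbitrary vector [t]: the term [a * <g, xi>] in [<g, eta>], with [a = <g, t>], has no sign, and
    Young's inequality bounds it by [mu a^2 |xi|^2 + |g|^2 / (4 mu)]. The correction in [beta]
    cancels the first summand; the second is the loss [1 / (4 mu)]. *)

Section Inner.
Context {R : realType} {n : nat} {M : riemannian R n} (x : M).
Implicit Types u v w : tangent x.

Lemma innerDr u v w : inner x u (v + w) = inner x u v + inner x u w.
Proof.
by have := inner_linear 1 v w u; rewrite scale1r mul1r ![inner x _ u]innerC.
Qed.

Lemma inner0r u : inner x u 0 = 0.
Proof. by apply: (addrI (inner x u 0)); rewrite -innerDr !addr0. Qed.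

Lemma innerZr (a : R) u v : inner x u (a *: v) = a * inner x u v.
Proof.
have := inner_linear a v 0 u.
by rewrite addr0 ![inner x _ u]innerC inner0r addr0.
Qed.

Lemma innerNr u v : inner x u (- v) = - inner x u v.
Proof. by rewrite -scaleN1r innerZr mulN1r. Qed.

Lemma inner_ge0 u : 0 <= inner x u u.
Proof.
by have [->|u0] := eqVneq u 0; [rewrite inner0r | apply/ltW/inner_gt0].
Qed.

Lemma sqr_tnorm u : tnorm u ^+ 2 = inner x u u.
Proof. by rewrite sqr_sqrtr ?inner_ge0. Qed.

Lemma inner_SD_le (mu : R) (g t xi : tangent x) : 0 < mu ->
  inner x g (- g + (inner x g xi - mu * tnorm xi ^+ 2 * inner x g t) *: t)
    <= - (1 - 1 / (4 * mu)) * tnorm g ^+ 2.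
Proof.
move=> mu_gt0; rewrite innerDr innerNr innerZr !sqr_tnorm.
set a := inner x g t; rewrite -subr_ge0.
(* The factor [2 mu a] completes the square: [|g - 2 mu a xi|^2] is exactly [4 mu] times the gap
   between the two sides. *)
have := inner_ge0 (g + (- (2 * mu * a)) *: xi).
rewrite innerDr innerZr ![inner x (g + _) _]innerC !innerDr !innerZr.
rewrite [inner x xi g]innerC => sq_ge0.
have mu4_gt0 : 0 < 4 * mu by rewrite mulr_gt0.
rewrite -(pmulr_rge0 _ mu4_gt0).
move: sq_ge0; congr (0 <= _); field; exact: lt0r_neq0.
Qed.

End Inner.

Theorem theorem3p4 (R : realType) (n : nat) (M : riemannian R n)
    (Q : retraction M) (f : M -> R) (mu : R)
    (x : nat -> M) (eta : forall k, tangent (x k)) (alpha beta : nat -> R)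
    (xi : forall k, tangent (x k))
    (f_smooth : smooth_fun f)
    (mu_gt : 1 / 4 < mu)
    (alpha_gt0 : forall k, 0 < alpha k)
    (eta_0 : eta 0%N = - grad f (x 0%N))
    (x_step : forall k, Q (x k) (alpha k *: eta k) = x k.+1)
    (eta_step : forall k,
       eta k.+1 = - grad f (x k.+1)
         + beta k.+1 *:
             tangent_cast (x_step k) (scaled_transport Q (alpha k *: eta k) (eta k)))
    (beta_SD : forall k,
       beta k.+1 =
         inner (x k.+1) (grad f (x k.+1)) (xi k.+1)
         - mu * tnorm (xi k.+1) ^+ 2
           * inner (x k.+1) (grad f (x k.+1))
               (tangent_cast (x_step k)
                  (scaled_transport Q (alpha k *: eta k) (eta k)))) :
  forall k : nat,
    inner (x k) (grad f (x k)) (eta k)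
      <= - (1 - 1 / (4 * mu)) * tnorm (grad f (x k)) ^+ 2.
Proof.
have mu_gt0 : 0 < mu by lra.
(* The whole cast vector is taken as [t], so the cast along [x_step] is never unfolded. *)
case=> [|k]; last by rewrite eta_step beta_SD inner_SD_le.
(* With [eta_0 = -g] it remains to see that [1 - 1 / (4 mu) <= 1]. *)
rewrite eta_0 innerNr sqr_tnorm mulNr lerN2 ler_piMl ?inner_ge0//.
by rewrite gerBl divr_ge0// mulr_ge0// ltW.
Qed.
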